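(* For every integer $k\ge 2$, the $k\times k$-grid $G_k$ has maximum matching width exactly $k$.
   Context: All graphs are finite and simple. The $k\times k$-grid $G_k$ has vertex set $\{(i,j):1\le i,j\le k\}$ and edge set $\{(i,j)(i',j') : |i-i'|+|j-j'|=1\}$. A tree is subcubic if every vertex has degree $1$ or $3$. A branch-decomposition of a finite set $X$ is a pair $(T,\mathcal{L})$ where $T$ is a subcubic tree and $\mathcal{L}$ is a bijection from the leaves of $T$ to $X$; each edge $e$ of $T$ induces a partition $(A,B)$ of $X$ according to the two components of $T-e$. For a graph $G$ and $A\subseteq V(G)$, $\operatorname{mm}_G(A)$ is the size of a maximum matching in the bipartite graph with vertex set $V(G)$ whose edges are the edges of $G$ with one end in $A$ and the other in $V(G)\setminus A$. The width of a branch-decomposition of $V(G)$ is the maximum of $\operatorname{mm}_G(A)$ over partitions $(A,B)$ induced by edges of $T$, and the maximum matching width $\operatorname{mmw}(G)$ is the minimum width over all branch-decompositions of $V(G)$. *)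

(* Defs.v *)
From mathcomp Require Import all_boot ssrint.
Set Implicit Arguments.
Unset Strict Implicit.
Unset Printing Implicit Defensive.

Record sgraph := SGraph {
  svertex :> finType;
  sedge : rel svertex;
  sedge_sym : symmetric sedge;
  sedge_irr : irreflexive sedge }.

Definition deg (G : sgraph) (x : G) : nat := #|[set y | sedge x y]|.

Definition connected (G : sgraph) : Prop :=
  0 < #|G| /\ forall x y : G, connect (@sedge G) x y.

Definition acyclic (G : sgraph) : Prop :=
  forall c : seq G, 2 < size c -> ~ ucycle (@sedge G) c.

Definition is_tree (G : sgraph) : Prop := connected G /\ acyclic G.

Definition subcubic (G : sgraph) : Prop :=
  forall x : G, deg x = 1 \/ deg x = 3.

Definition leaf (G : sgraph) : finType := {x : G | deg x == 1}.

Section DelEdge.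
Variables (G : sgraph) (u v : G).

Definition del_edge_rel : rel G :=
  fun x y => sedge x y && ([set x; y] != [set u; v]).

Lemma del_edge_sym : symmetric del_edge_rel.
Proof. by move=> x y; rewrite /del_edge_rel sedge_sym setUC. Qed.

Lemma del_edge_irr : irreflexive del_edge_rel.
Proof. by move=> x; rewrite /del_edge_rel sedge_irr. Qed.

Definition del_edge : sgraph := SGraph del_edge_sym del_edge_irr.
End DelEdge.

Record branch_decomposition (X : finType) := BranchDecomposition {
  bd_tree : sgraph;
  bd_is_tree : is_tree bd_tree;
  bd_subcubic : subcubic bd_tree;
  bd_label : leaf bd_tree -> X;
  bd_label_bij : bijective bd_label }.

(* For an edge uv of the tree, the side of the induced partition of X formed by
   the labels of the leaves in the component of T - uv containing u; the other
   side is bd_side D v u. *)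
Definition bd_side (X : finType) (D : branch_decomposition X)
    (u v : bd_tree D) : {set X} :=
  [set bd_label x | x : leaf (bd_tree D)
                  & connect (@sedge (del_edge u v)) u (val x)].

Definition edge_set (G : sgraph) : {set {set G}} :=
  [set [set p.1; p.2] | p : G * G & sedge p.1 p.2].

Definition matching (G : sgraph) (M : {set {set G}}) : bool :=
  (M \subset edge_set G) && trivIset M.

Definition max_matching (G : sgraph) : nat :=
  \max_(M : {set {set G}} | matching M) #|M|.

Section CutGraph.
Variables (G : sgraph) (A : {set G}).

Definition cut_rel : rel G :=
  fun x y => sedge x y && ((x \in A) != (y \in A)).

Lemma cut_sym : symmetric cut_rel.
Proof. by move=> x y; rewrite /cut_rel sedge_sym eq_sym. Qed.

Lemma cut_irr : irreflexive cut_rel.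
Proof. by move=> x; rewrite /cut_rel sedge_irr. Qed.

Definition cut_graph : sgraph := SGraph cut_sym cut_irr.
End CutGraph.

Definition mm (G : sgraph) (A : {set G}) : nat := max_matching (cut_graph A).

(* Each edge of the tree is counted in both orientations, i.e. both sides of
   each induced partition are considered. *)
Definition bd_width (G : sgraph) (D : branch_decomposition G) : nat :=
  \max_(p : bd_tree D * bd_tree D | sedge p.1 p.2) mm (bd_side p.1 p.2).

(* mmw(G) = w. A relation rather than a function, because a graph with at most
   one vertex has no branch-decomposition. *)
Definition mmw_is (G : sgraph) (w : nat) : Prop :=
  (exists D : branch_decomposition G, bd_width D = w) /\
  (forall D : branch_decomposition G, w <= bd_width D).

Section Grid.
Variable k : nat.

(* Coordinates run over 0, ..., k - 1 instead of 1, ..., k. *)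
Definition grid_rel : rel ('I_k * 'I_k)%type :=
  fun p q => `|p.1 - q.1|%N + `|p.2 - q.2|%N == 1.

Lemma grid_sym : symmetric grid_rel.
Proof. by move=> p q; rewrite /grid_rel distnC [X in _ + X]distnC. Qed.

Lemma grid_irr : irreflexive grid_rel.
Proof. by move=> p; rewrite /grid_rel !distnn. Qed.

Definition grid : sgraph := SGraph grid_sym grid_irr.
End Grid.

(* Main.v *)
Require Import Defs.
From mathcomp Require Import all_boot zify.
Set Implicit Arguments.
Unset Strict Implicit.
Unset Printing Implicit Defensive.

(** Upper bound: in the caterpillar whose leaves list the cells in row-major order,
    every cut separates a prefix from a suffix (or a single cell from the rest), and
    the last [k] cells of a prefix cover its cut edges.

    Lower bound: if all cuts had matching number below [k], then for each cut exactly
    one side would contain a full row, since otherwise the [k] rows each contain a cut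
    edge.  Following the sides that contain a row leads to a cubic node whose three
    parts contain no full row or column.  This contradicts the claim that in every
    3-colouring of the [k x k] grid without monochromatic row or column some colour
    class has a cut matching of size [k].  The claim is proved by induction on [k].
    If two adjacent sides of the square together carry all three colours, delete them:
    the smaller grid provides [k - 1] edges and the deleted hook one more; if the smaller
    grid has a monochromatic line, then that hook or the full lines supply the edges.
    Otherwise the boundary carries only two colours [a] and [b].  Unless the
    rows or columns already give [k] edges, some row and some column avoid [a]; joining
    the boundary cells of colour [a] to this cross by disjoint segments, in two
    mirror-image pinwheels, gives two matchings for [a], and likewise for [b].  The four
    matchings together have [4 k] edges. *)

(** * Cut matchings of the square *)

(** Coordinates are unbounded, so a colouring for side [k.+1] serves unchanged for side [k] in the
    induction. *)
Definition cell := (nat * nat)%type.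

Definition cell_adj (p q : cell) : bool :=
  (p.1 == q.1) && ((p.2 == q.2.+1) || (q.2 == p.2.+1)) ||
  (p.2 == q.2) && ((p.1 == q.1.+1) || (q.1 == p.1.+1)).

Definition inside (k : nat) (p : cell) : bool := (p.1 < k) && (p.2 < k).

Definition cut_edge (k : nat) (A : pred cell) (e : cell * cell) : bool :=
  [&& inside k e.1, inside k e.2, cell_adj e.1 e.2 & A e.1 != A e.2].

Definition endpoints (T : Type) (s : seq (T * T)) : seq T :=
  flatten [seq [:: e.1; e.2] | e <- s].

Definition has_cut_matching (k : nat) (A : pred cell) (n : nat) : Prop :=
  exists s, [/\ n <= size s, all (cut_edge k A) s & uniq (endpoints s)].

Lemma endpoints_map (T U : Type) (g : T -> U) (s : seq (T * T)) :
  endpoints [seq (g e.1, g e.2) | e <- s] = map g (endpoints s).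
Proof. by elim: s => //= e s; rewrite /endpoints /= => ->. Qed.

Lemma mem_endpoints (T : eqType) (s : seq (T * T)) x :
  x \in endpoints s -> exists2 e, e \in s & (x == e.1) || (x == e.2).
Proof.
case/flatten_mapP=> e es; rewrite !inE => xe; by exists e.
Qed.

Lemma has_cut_matching_le k A m n :
  m <= n -> has_cut_matching k A n -> has_cut_matching k A m.
Proof. by move=> mn [s [h1 h2 h3]]; exists s; split=> //; exact: leq_trans h1. Qed.

(** Symmetries of the square carry cut matchings along; the instances are transposition and the
    upside-down reflection. *)
Lemma has_cut_matching_map k (g : cell -> cell) A n :
  {in inside k &, injective g} -> (forall p, inside k p -> inside k (g p)) ->
  (forall p q, inside k p -> inside k q -> cell_adj p q -> cell_adj (g p) (g q)) ->
  has_cut_matching k (A \o g) n -> has_cut_matching k A n.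
Proof.
move=> ginj gin gadj [s [ns /allP cs us]].
exists [seq (g e.1, g e.2) | e <- s]; split; first by rewrite size_map.
  apply/allP=> _ /mapP [e /cs /and4P [h1 h2 h3 h4] ->].
  by apply/and4P; split; rewrite /= ?gin ?gadj.
rewrite endpoints_map map_inj_in_uniq // => x y.
move=> /mem_endpoints [e /cs /and4P [h1 h2 _ _] he].
move=> /mem_endpoints [e' /cs /and4P [h1' h2' _ _] he'].
apply: ginj.
  by case/orP: he => /eqP ->.
by case/orP: he' => /eqP ->.
Qed.

Definition swap (p : cell) : cell := (p.2, p.1).

Lemma has_cut_matching_swap k A n :
  has_cut_matching k (A \o swap) n -> has_cut_matching k A n.
Proof.
apply: has_cut_matching_map.
- by move=> [? ?] [? ?] _ _ [-> ->].
- by move=> p /andP [h1 h2]; apply/andP.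
- by move=> p q _ _; rewrite /cell_adj /= orbC.
Qed.

Definition flip (k : nat) (p : cell) : cell := (k.-1 - p.1, p.2).

Lemma has_cut_matching_flip k A n :
  has_cut_matching k (A \o flip k) n -> has_cut_matching k A n.
Proof.
apply: has_cut_matching_map.
- move=> [a b] [c d]; rewrite /inside !unfold_in /= => h1 h2 [h3 ->].
  by congr (_, _); lia.
- by move=> p; rewrite /inside /=; lia.
- by move=> p q; rewrite /cell_adj /inside /=; lia.
Qed.

(* The edges are disjoint because the endpoints of each one carry its own key. *)
Lemma has_cut_matching_key (J : eqType) k A (js : seq J) (key : cell -> J) :
  uniq js ->
  (forall j, j \in js -> exists e, [/\ cut_edge k A e, key e.1 = j & key e.2 = j]) ->
  has_cut_matching k A (size js).
Proof.
move=> ujs hjs.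
suff [s [h1 h2 h3 _]] : exists s, [/\ size js = size s, all (cut_edge k A) s,
    uniq (endpoints s) & all (fun p => key p \in js) (endpoints s)].
  by exists s; split=> //; rewrite h1.
elim: js ujs hjs => [|j js IH] /=; first by exists [::].
case/andP=> jjs ujs hjs.
case: IH => // [i ijs|s [h1 h2 h3 h4]].
  by apply: hjs; rewrite inE ijs orbT.
have [e [ce k1 k2]] := hjs j (mem_head _ _).
have nin x : key x = j -> x \notin endpoints s.
  by move=> kx; apply/negP=> /(allP h4); rewrite kx (negbTE jjs).
exists (e :: s); split=> //=; first by rewrite h1.
- by rewrite ce.
- rewrite -/(endpoints s) inE negb_or !nin //= h3 !andbT.
  case/and4P: ce => _ _ _; by apply: contraNneq => ->.
- rewrite -/(endpoints s) k1 k2 !inE eqxx /=.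
  by apply/allP=> x /(allP h4) hx; rewrite inE hx orbT.
Qed.

Lemma walk_cut (A : pred cell) (g : nat -> cell) a b :
  a <= b -> A (g a) != A (g b) ->
  exists t, [/\ a <= t, t < b & A (g t) != A (g t.+1)].
Proof.
elim: b => [|b IH]; first by rewrite leqn0 => /eqP ->; rewrite eqxx.
rewrite leq_eqVlt => /orP [/eqP <-|]; first by rewrite eqxx.
rewrite ltnS => ab hne.
have [e|ne] := eqVneq (A (g a)) (A (g b)).
  by exists b; split=> //; rewrite -e.
have [t [h1 h2 h3]] := IH ab ne.
by exists t; split=> //; lia.
Qed.

Lemma walk_cut_sym (A : pred cell) (g : nat -> cell) a b :
  A (g a) != A (g b) ->
  exists t, [/\ minn a b <= t, t < maxn a b & A (g t) != A (g t.+1)].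
Proof.
move=> hne; case: (leqP a b) => [ab|/ltnW ba]; first exact: walk_cut.
by apply: walk_cut => //; rewrite eq_sym.
Qed.

(** The bounds on [t] keep the cut edge inside the segment; the pinwheel argument needs them for
    disjointness. *)
Lemma row_cut k A i j j' : i < k -> j < k -> j' < k -> A (i, j) != A (i, j') ->
  exists t, [/\ minn j j' <= t, t < maxn j j' & cut_edge k A ((i, t), (i, t.+1))].
Proof.
move=> ik jk jk' /(@walk_cut_sym A (fun t => (i, t))) [t [h1 h2 h3]].
exists t; split=> //; rewrite /cut_edge /inside /cell_adj /= h3 andbT; lia.
Qed.

Lemma column_cut k A j i i' : j < k -> i < k -> i' < k -> A (i, j) != A (i', j) ->
  exists t, [/\ minn i i' <= t, t < maxn i i' & cut_edge k A ((t, j), (t.+1, j))].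
Proof.
move=> jk ik ik' /(@walk_cut_sym A (fun t => (t, j))) [t [h1 h2 h3]].
exists t; split=> //; rewrite /cut_edge /inside /cell_adj /= h3 andbT; lia.
Qed.

(** * Colourings with mixed rows and columns *)

Definition colour_class (f : cell -> nat) (c : nat) : pred cell :=
  fun p => f p == c.

(** Composing with [swap] gives the same notion for columns. [T] is [nat] for colourings and [bool]
    for sets of cells. *)
Definition rows_mixed (T : eqType) (k : nat) (f : cell -> T) : Prop :=
  forall i, i < k -> exists j j', [/\ j < k, j' < k & f (i, j) != f (i, j')].

Lemma rows_mixed_dec (T : eqType) k (f : cell -> T) :
  rows_mixed k f \/
  exists r c, r < k /\ forall j, j < k -> f (r, j) = c.
Proof.
case: (boolP [forall i : 'I_k, exists j : 'I_k, exists j' : 'I_k,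
               f (i : nat, j : nat) != f (i : nat, j' : nat)]).
  move/forallP=> h; left=> i ik; move: (h (Ordinal ik)).
  by case/existsP=> j /existsP [j' hj]; exists j, j'.
case/forallPn=> i /existsPn h; right; exists (i : nat), (f (i : nat, i : nat)).
split=> // j jk; move: (h i) => /existsPn /(_ (Ordinal jk)).
by rewrite negbK eq_sym => /eqP.
Qed.

Lemma rows_mixed_other k (f : cell -> nat) c i : rows_mixed k f -> i < k ->
  exists2 j, j < k & f (i, j) != c.
Proof.
move=> h /h [j [j' [jk jk' ne]]].
have [e|nec] := eqVneq (f (i, j)) c; last by exists j.
by exists j' => //; rewrite -e eq_sym.
Qed.

(** Each row supplies a horizontal cut edge, with the row index as key. *)
Lemma rows_matching k A : rows_mixed k A -> has_cut_matching k A k.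
Proof.
move=> hm; rewrite -{2}(size_iota 0 k).
apply: (has_cut_matching_key (key := fun p => p.1)); first exact: iota_uniq.
move=> i; rewrite mem_iota /= add0n => ik; have [j [j' [jk jk' ne]]] := hm i ik.
have [t [_ _ ht]] := row_cut ik jk jk' ne.
by exists ((i, t), (i, t.+1)).
Qed.

Lemma colour_rows_matching k f c : rows_mixed k f ->
  (forall i, i < k -> exists2 j, j < k & f (i, j) = c) ->
  has_cut_matching k (colour_class f c) k.
Proof.
move=> hm hc; apply: rows_matching => i ik.
have [j jk e] := hc i ik; have [j' jk' ne] := rows_mixed_other c hm ik.
by exists j, j'; rewrite /colour_class e eqxx eq_sym eqb_id.
Qed.

(* [g] walks down the last column and then back along the last row. *)
Lemma has_cut_matching_hook k (A : pred cell) n a b : a <= k + k -> b <= k + k ->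
  let g t := if t <= k then (t, k) else (k, k + k - t) in
  A (g a) != A (g b) -> has_cut_matching k A n -> has_cut_matching k.+1 A n.+1.
Proof.
move=> ak bk g /walk_cut_sym [t [h1 h2 h3]] [s [hs cs us]].
exists ((g t, g t.+1) :: s); split=> //=.
  apply/andP; split.
    rewrite /cut_edge /= h3 andbT /g /inside /cell_adj.
    by case: (ltnP t k) => ?; case: (leqP t k) => ? /=; lia.
  apply/allP=> e /(allP cs) /and4P [i1 i2 ad ne]; apply/and4P; split=> //.
    by move: i1; rewrite /inside; lia.
  by move: i2; rewrite /inside; lia.
(* Every hook cell has a coordinate equal to [k], so no edge of the smaller square touches it. *)
have out u : u <= k + k -> g u \notin endpoints s.
  move=> uk; apply/negP=> /mem_endpoints [e /(allP cs) /and4P [i1 i2 _ _] he].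
  suff: inside k (g u) by rewrite /inside /g; case: (leqP u k) => /=; lia.
  by case/orP: he => /eqP ->.
rewrite -/(endpoints s) inE negb_or !out ?us ?andbT; try lia.
by apply: contraNneq h3 => ->.
Qed.

(** The walk along the hook visits [(t, k)] at time [t] and [(k, t)] at time [k + k - t]. *)
Lemma hook_index k (P : cell -> Prop) t : t <= k -> P (k, t) \/ P (t, k) ->
  exists2 a, a <= k + k & P (if a <= k then (a, k) else (k, k + k - a)).
Proof.
move=> tk [h|h]; last by exists t; [lia|rewrite tk].
exists (k + k - t); first by lia.
case: (leqP (k + k - t) k) => h'.
  have e : t = k by lia.
  by move: h; rewrite e; have -> : k + k - k = k by lia.
by have -> : k + k - (k + k - t) = t by lia.
Qed.

(** * Induction step with a trichromatic hook *)

Definition hook_trichromatic k (f : cell -> nat) : Prop :=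
  forall c, c < 3 -> exists2 t, t <= k & f (k, t) = c \/ f (t, k) = c.

(** The hook carries [c] and some other colour, so the walk along it crosses the cut. *)
Lemma has_colour_matching_hook k f c n : c < 3 -> hook_trichromatic k f ->
  has_cut_matching k (colour_class f c) n ->
  has_cut_matching k.+1 (colour_class f c) n.+1.
Proof.
move=> c3 tri.
have [c' [c3' ne]] : exists c', c' < 3 /\ c' != c.
  by case: c {c3} => [|c]; [exists 1|exists 0].
have [t tk /(@hook_index k (fun p => f p = c) t tk) [a ak ha]] := tri c c3.
have [t' tk' /(@hook_index k (fun p => f p = c') t' tk') [b bk hb]] := tri c' c3'.
apply: (has_cut_matching_hook ak bk).
by rewrite /colour_class ha hb eqxx (negbTE ne).
Qed.

(** If every column of the smaller square is cut by the class of [c], these columns and the hook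
    give the edges. Otherwise an uncut column meets row [r] and so has colour [c] throughout. Then
    all rows and columns of the smaller square contain [c], and the hook supplies [c] for the last
    row or the last column, so all rows or all columns of the larger square are cut. *)
Lemma mono_row_matching k f r c : c < 3 ->
  rows_mixed k.+1 f -> rows_mixed k.+1 (f \o swap) -> hook_trichromatic k f ->
  r < k -> (forall j, j < k -> f (r, j) = c) ->
  has_cut_matching k.+1 (colour_class f c) k.+1.
Proof.
move=> c3 hr hc tri rk rowc.
case: (rows_mixed_dec k (colour_class f c \o swap)) => [h|[j [b [jk hj]]]].
  apply: (has_colour_matching_hook c3 tri).
  by apply: has_cut_matching_swap; apply: rows_matching.
have colc i : i < k -> f (i, j) = c.
  move=> ik; apply/eqP; have := hj i ik; rewrite /= /colour_class /swap /= => ->.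
  by rewrite -(hj r rk) /= /colour_class /swap /= rowc.
have [t tk [ht|ht]] := tri c c3.
  apply: colour_rows_matching => // i; rewrite ltnS leq_eqVlt => /orP [/eqP ->|ik].
    by exists t.
  by exists j; [lia|exact: colc].
apply: has_cut_matching_swap.
apply: (@colour_rows_matching k.+1 (f \o swap)) => // i; rewrite ltnS leq_eqVlt => /orP [/eqP ->|ik].
  by exists t.
by exists r; [lia|exact: rowc].
Qed.

Definition three_colour_at k : Prop := forall f : cell -> nat,
  (forall p, f p < 3) -> rows_mixed k f -> rows_mixed k (f \o swap) ->
  exists2 c, c < 3 & has_cut_matching k (colour_class f c) k.

Lemma three_colour_hook k f : three_colour_at k -> (forall p, f p < 3) ->
  rows_mixed k.+1 f -> rows_mixed k.+1 (f \o swap) -> hook_trichromatic k f ->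
  exists2 c, c < 3 & has_cut_matching k.+1 (colour_class f c) k.+1.
Proof.
move=> IH f3 hr hc tri.
case: (rows_mixed_dec k f) => [h1|[r [c [rk rowc]]]]; last first.
  have c3 : c < 3 by rewrite -(rowc r rk).
  by exists c => //; apply: (mono_row_matching c3 hr hc tri rk rowc).
case: (rows_mixed_dec k (f \o swap)) => [h2|[r [c [rk rowc]]]]; last first.
  have c3 : c < 3 by rewrite -(rowc r rk); exact: f3.
  exists c => //; apply: has_cut_matching_swap.
  apply: (@mono_row_matching k (f \o swap) r c) => //.
  by move=> c' /tri [t tk [h|h]]; exists t => //; [right|left].
have [c c3 hm] := IH f f3 h1 h2.
by exists c => //; apply: has_colour_matching_hook.
Qed.

(** * Pinwheels around a cross *)

(** Segments run from the top side down to row [r], from the right side left to column [c], from the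
    bottom up to row [r], and from the left side right to column [c]. A segment starting in [A] ends
    outside [A], hence contains a cut edge. *)
Lemma pinwheel_matching n (A : pred cell) r c : r < n -> c < n ->
  (forall j, j < n -> ~~ A (r, j)) -> (forall i, i < n -> ~~ A (i, c)) ->
  has_cut_matching n A
   (count (fun j => (c < j) && A (0, j)) (iota 0 n) +
    (count (fun i => (r < i) && A (i, n.-1)) (iota 0 n) +
     (count (fun j => (j < c) && A (n.-1, j)) (iota 0 n) +
      count (fun i => (i < r) && A (i, 0)) (iota 0 n)))).
Proof.
move=> rn cn rowr colc.
pose P (x : nat * nat) := let: (d, i) := x in
  match d with
  | 0 => (c < i) && A (0, i)
  | 1 => (r < i) && A (i, n.-1)
  | 2 => (i < c) && A (n.-1, i)
  | _ => (i < r) && A (i, 0)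
  end.
pose js := [seq x <- [seq (d, i) | d <- iota 0 4, i <- iota 0 n] | P x].
(* The four arms of the pinwheel occupy disjoint rectangles; the key of a cell is its arm and the
   column or row of its segment. *)
pose key (p : cell) :=
  if (c < p.2) && (p.1 <= r) then (0, p.2) else
  if (r < p.1) && (c <= p.2) then (1, p.1) else
  if (p.2 < c) && (r <= p.1) then (2, p.2) else (3, p.1).
have <- : size js = count (fun j => (c < j) && A (0, j)) (iota 0 n) +
    (count (fun i => (r < i) && A (i, n.-1)) (iota 0 n) +
     (count (fun j => (j < c) && A (n.-1, j)) (iota 0 n) +
      count (fun i => (i < r) && A (i, 0)) (iota 0 n))).
  by rewrite size_filter /= !count_cat !count_map /= addn0.
apply: (has_cut_matching_key (key := key)).
  apply: filter_uniq; apply: allpairs_uniq; try exact: iota_uniq.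
  by move=> [? ?] [? ?] _ _ [-> ->].
move=> [d i]; rewrite mem_filter => /andP [Pi /allpairsP [[d' i'] [/= hd]]].
rewrite mem_iota /= => hi [ed ei]; move: hd; rewrite -ed => hd.
have {ei} hi : i < n by rewrite ei.
have ne x y : A x -> ~~ A y -> A x != A y by move=> -> /negbTE ->.
case: d Pi hd {ed} => [|[|[|[|//]]]] /= /andP [h1 h2] _.
- have n0 : 0 < n by lia.
  have [t [t1 t2 ht]] := column_cut hi n0 rn (ne _ _ h2 (rowr i hi)).
  by exists ((t, i), (t.+1, i)); split=> //; rewrite /key /=; do !case: ifP => //; lia.
- have n1 : n.-1 < n by lia.
  have [t [t1 t2 ht]] := row_cut hi n1 cn (ne _ _ h2 (colc i hi)).
  by exists ((i, t), (i, t.+1)); split=> //; rewrite /key /=; do !case: ifP => //; lia.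
- have n1 : n.-1 < n by lia.
  have [t [t1 t2 ht]] := column_cut hi n1 rn (ne _ _ h2 (rowr i hi)).
  by exists ((t, i), (t.+1, i)); split=> //; rewrite /key /=; do !case: ifP => //; lia.
- have n0 : 0 < n by lia.
  have [t [t1 t2 ht]] := row_cut hi n0 cn (ne _ _ h2 (colc i hi)).
  by exists ((i, t), (i, t.+1)); split=> //; rewrite /key /=; do !case: ifP => //; lia.
Qed.

Lemma count_split_at n (P : pred nat) c : ~~ P c ->
  count (fun j => (j < c) && P j) (iota 0 n) +
  count (fun j => (c < j) && P j) (iota 0 n) = count P (iota 0 n).
Proof.
move=> nPc; rewrite -count_predUI -[RHS]addn0; congr (_ + _).
  by apply: eq_count => j /=; case: (ltngtP j c) => //= [_|->]; rewrite ?orbF ?(negbTE nPc).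
by rewrite (@eq_count _ _ pred0) ?count_pred0 // => j /=; case: (ltngtP j c) => //=; rewrite andbF.
Qed.

Definition avoiding_cross n (A : pred cell) : Prop := exists r c,
  [/\ r < n, c < n, forall j, j < n -> ~~ A (r, j) & forall i, i < n -> ~~ A (i, c)].

(* The two mirror-image pinwheels together use every boundary cell of [A] once
   for each side of the square that contains it. *)
Lemma avoiding_cross_matching n (A : pred cell) : avoiding_cross n A ->
  exists m1 m2, [/\ has_cut_matching n A m1, has_cut_matching n A m2 &
  m1 + m2 = count (fun j => A (0, j)) (iota 0 n) +
            count (fun j => A (n.-1, j)) (iota 0 n) +
            (count (fun i => A (i, 0)) (iota 0 n) +
             count (fun i => A (i, n.-1)) (iota 0 n))].
Proof.
case=> r [c [rn cn rowr colc]].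
have h1 := pinwheel_matching rn cn rowr colc.
have h2 := has_cut_matching_swap (@pinwheel_matching n (A \o swap) c r cn rn colc rowr).
eexists; eexists; split; [exact: h1|exact: h2|].
rewrite /swap /=.
have n0 : 0 < n by lia.
have n1 : n.-1 < n by lia.
rewrite -(@count_split_at n (fun j => A (0, j)) c) ?colc //.
rewrite -(@count_split_at n (fun j => A (n.-1, j)) c) ?colc //.
rewrite -(@count_split_at n (fun i => A (i, 0)) r) ?rowr //.
rewrite -(@count_split_at n (fun i => A (i, n.-1)) r) ?rowr //.
lia.
Qed.

(** A row not cut by the class lies inside or outside it; being mixed, it has a cell of another
    colour and so lies outside. *)
Lemma colour_matching_or_row k f c : rows_mixed k f ->
  has_cut_matching k (colour_class f c) k \/
  exists2 r, r < k & forall j, j < k -> ~~ colour_class f c (r, j).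
Proof.
move=> hr; case: (rows_mixed_dec k (colour_class f c)) => [h|[r [b [rk hb]]]].
  by left; apply: rows_matching.
right; exists r => // j jk; rewrite hb //.
have [j' jk' ne] := rows_mixed_other c hr rk.
by rewrite -(hb j' jk').
Qed.

Lemma colour_matching_or_cross k f c : rows_mixed k f -> rows_mixed k (f \o swap) ->
  has_cut_matching k (colour_class f c) k \/ avoiding_cross k (colour_class f c).
Proof.
move=> hr hc; case: (colour_matching_or_row c hr) => [|[r rk hrow]]; first by left.
case: (colour_matching_or_row c hc) => [h|[j jk hcol]].
  by left; apply: has_cut_matching_swap.
by right; exists r, j.
Qed.

Lemma bichromatic_boundary_matching n f a b : a != b ->
  rows_mixed n f -> rows_mixed n (f \o swap) ->
  (forall i, i < n -> [/\ f (0, i) \in [:: a; b], f (n.-1, i) \in [:: a; b],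
                         f (i, 0) \in [:: a; b] & f (i, n.-1) \in [:: a; b]]) ->
  exists2 c, c \in [:: a; b] & has_cut_matching n (colour_class f c) n.
Proof.
move=> nab hr hc hb.
have ina : a \in [:: a; b] by rewrite inE eqxx.
have inb : b \in [:: a; b] by rewrite !inE eqxx orbT.
case: (colour_matching_or_cross a hr hc) => [|/avoiding_cross_matching]; first by exists a.
move=> [a1 [a2 [ma1 ma2 sa]]].
case: (colour_matching_or_cross b hr hc) => [|/avoiding_cross_matching]; first by exists b.
move=> [b1 [b2 [mb1 mb2 sb]]].
(* Each boundary cell has exactly one of the two colours, so each side contributes [n] and the four
   matchings have [4 * n] edges in total. *)
have side (g : nat -> cell) : (forall i, i < n -> f (g i) \in [:: a; b]) ->
    count (fun i => colour_class f a (g i)) (iota 0 n) +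
    count (fun i => colour_class f b (g i)) (iota 0 n) = n.
  move=> hg; rewrite -[RHS](size_iota 0 n) -count_predUI.
  rewrite [X in _ + X](@eq_in_count _ _ pred0); last first.
    move=> i _ /=; rewrite /colour_class; apply/negP => /andP [/eqP -> /eqP e].
    by rewrite e eqxx in nab.
  rewrite count_pred0 addn0; apply/eqP; rewrite -all_count; apply/allP=> i.
  rewrite mem_iota /= => /hg; by rewrite !inE.
have e1 := side (fun j => (0, j)) (fun i h => let: And4 x _ _ _ := hb i h in x).
have e2 := side (fun j => (n.-1, j)) (fun i h => let: And4 _ x _ _ := hb i h in x).
have e3 := side (fun i => (i, 0)) (fun i h => let: And4 _ _ x _ := hb i h in x).
have e4 := side (fun i => (i, n.-1)) (fun i h => let: And4 _ _ _ x := hb i h in x).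
have : [|| n <= a1, n <= a2, n <= b1 | n <= b2] by lia.
case/or4P => le.
- by exists a => //; apply: has_cut_matching_le ma1.
- by exists a => //; apply: has_cut_matching_le ma2.
- by exists b => //; apply: has_cut_matching_le mb1.
- by exists b => //; apply: has_cut_matching_le mb2.
Qed.

(** * Induction on the side of the square *)

Lemma hook_trichromatic_dec k f : hook_trichromatic k f \/
  exists2 c, c < 3 & forall t, t <= k -> f (k, t) != c /\ f (t, k) != c.
Proof.
pose b := all (fun c => has (fun t => (f (k, t) == c) || (f (t, k) == c)) (iota 0 k.+1))
              (iota 0 3).
case: (boolP b) => [/allP h|/allPn [c]].
  left=> c c3; have /hasP [t] := h c (etrans (mem_iota 0 3 c) c3).
  rewrite mem_iota => tk h'; exists t; first by lia.
  by case/orP: h' => /eqP; [left|right].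
rewrite mem_iota => c3 /hasPn h; right; exists c => // t tk.
have /h : t \in iota 0 k.+1 by rewrite mem_iota; lia.
by rewrite negb_or => /andP [].
Qed.

Lemma three_colour_hook_dec k f : three_colour_at k -> (forall p, f p < 3) ->
  rows_mixed k.+1 f -> rows_mixed k.+1 (f \o swap) ->
  (exists2 c, c < 3 & has_cut_matching k.+1 (colour_class f c) k.+1) \/
  exists2 c, c < 3 & forall t, t <= k -> f (k, t) != c /\ f (t, k) != c.
Proof.
move=> IH f3 hr hc; case: (hook_trichromatic_dec k f) => [tri|]; last by right.
by left; apply: three_colour_hook.
Qed.

Lemma rows_mixed_flip (T : eqType) k (f : cell -> T) : rows_mixed k f -> rows_mixed k (f \o flip k).
Proof.
move=> h i ik; have /h [j [j' [jk jk' ne]]] : k.-1 - i < k by lia.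
by exists j, j'.
Qed.

Lemma columns_mixed_flip (T : eqType) k (f : cell -> T) :
  rows_mixed k (f \o swap) -> rows_mixed k (f \o flip k \o swap).
Proof.
move=> h i ik; have [j [j' [jk jk' ne]]] := h i ik.
exists (k.-1 - j), (k.-1 - j'); split; try lia.
rewrite /flip /swap /=.
by have [-> ->] : k.-1 - (k.-1 - j) = j /\ k.-1 - (k.-1 - j') = j' by lia.
Qed.

(** Turning the square upside down exchanges the hook of last row and last column for that of first
    row and last column. *)
Lemma three_colour_flip_dec k f : three_colour_at k -> (forall p, f p < 3) ->
  rows_mixed k.+1 f -> rows_mixed k.+1 (f \o swap) ->
  (exists2 c, c < 3 & has_cut_matching k.+1 (colour_class f c) k.+1) \/
  exists2 c, c < 3 & forall t, t <= k -> f (0, t) != c /\ f (t, k) != c.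
Proof.
move=> IH f3 hr hc.
case: (three_colour_hook_dec IH (fun p => f3 (flip k.+1 p)) (rows_mixed_flip hr)
  (columns_mixed_flip hc)).
- by move=> [c c3 hm]; left; exists c => //; apply: has_cut_matching_flip.
- move=> [c c3 h]; right; exists c => // t tk; split.
    by have [+ _] := h t tk; rewrite /flip /= subnn.
  have [_] := h (k - t) (leq_subr _ _); rewrite /flip /=.
  by have -> : k - (k - t) = t by lia.
Qed.

(** A line showing two of the three colours can miss only one. *)
Lemma missing_colour_uniq k (g : nat -> nat) x y c d :
  (forall t, g t < 3) -> c < 3 -> d < 3 -> x <= k -> y <= k -> g x != g y ->
  (forall t, t <= k -> g t != c) -> (forall t, t <= k -> g t != d) -> c = d.
Proof.
move=> g3 c3 d3 xk yk ne hc hd.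
have := g3 x; have := g3 y; have := hc x xk; have := hc y yk.
have := hd x xk; have := hd y yk; lia.
Qed.

Lemma three_colour k : three_colour_at k.
Proof.
elim: k => [|k IH] f f3 hr hc; first by exists 0 => //; exists [::].
case: (three_colour_hook_dec IH f3 hr hc) => [//|[c c3 h1]].
case: (three_colour_flip_dec IH f3 hr hc) => [//|[c2 c23 h2]].
(* After transposition the hook consists of the first column and the last row. *)
case: (@three_colour_flip_dec k (f \o swap) IH (fun p => f3 (swap p)) hc hr) => [[c' c3' hm]|[d d3 h3]].
  by exists c' => //; apply: has_cut_matching_swap.
(* The hooks share the last column, or below the last row. These lines are mixed, so all three hooks
   miss the same colour, and together they cover the boundary. *)
have {c23} ec2 : c = c2.
  have [x [y [xk yk ne]]] := hc k (ltnSn k).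
  apply: (@missing_colour_uniq k (fun t => f (t, k)) x y) => // t tk.
    by have [] := h1 t tk.
  by have [] := h2 t tk.
have {d3} ed : c = d.
  have [x [y [xk yk ne]]] := hr k (ltnSn k).
  apply: (@missing_colour_uniq k (fun t => f (k, t)) x y) => // t tk.
    by have [] := h1 t tk.
  by have [] := h3 t tk.
subst c2 d.
have [a [b [ab a3 b3 ha]]] : exists a b, [/\ a != b, a < 3, b < 3 &
    forall x, x < 3 -> x != c -> x \in [:: a; b]].
  by case: c c3 {h1 h2 h3} => [|[|[|//]]] _; [exists 1, 2|exists 0, 2|exists 0, 1];
    split=> // [] [|[|[|]]].
have [i ik|c' hc' hm] := bichromatic_boundary_matching ab hr hc.
  have ik' : i <= k by [].
  have [p1 p2] := h1 i ik'; have [p3 _] := h2 i ik'; have [p4 _] := h3 i ik'.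
  by split; apply: ha.
by exists c' => //; move: hc'; rewrite !inE => /orP [] /eqP ->.
Qed.

(** * Matching number of a cut *)

(** Distinct endpoints make the edges disjoint nonempty sets, so the list and the set of its edges
    have equal size. *)
Lemma max_matching_ge (G : sgraph) (s : seq (G * G)) :
  all (fun e => sedge e.1 e.2) s -> uniq (endpoints s) -> size s <= max_matching G.
Proof.
move=> es us; pose ed (e : G * G) := [set e.1; e.2].
have disj e : e \in s -> forall e', e' \in s -> e = e' \/ [disjoint ed e & ed e'].
  elim: s us {es} => //= a s IH; rewrite -/(endpoints s) inE negb_or.
  case/and3P=> /andP [_ a1] a2 us.
  have da e0 : e0 \in s -> [disjoint ed a & ed e0].
    move=> e0s; apply/pred0P=> x /=; rewrite !inE; apply/negP=> /andP [ha he].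
    have : x \in endpoints s by apply/flatten_mapP; exists e0; rewrite ?inE.
    by case/orP: ha => /eqP -> h; rewrite h in a1 a2.
  rewrite inE => /orP [/eqP ->|hes] e'; rewrite inE => /orP [/eqP ->|hes'].
  - by left.
  - by right; apply: da.
  - by right; rewrite disjoint_sym; apply: da.
  - exact: IH.
have nz e : ~~ [disjoint ed e & ed e].
  by apply/pred0Pn; exists e.1; rewrite /= !inE eqxx.
have us' : uniq s.
  elim: s us {es disj} => //= a s IH; rewrite -/(endpoints s) => /and3P [h1 _ h2].
  rewrite IH // andbT; apply: contra h1 => h; rewrite inE; apply/orP; right.
  by apply/flatten_mapP; exists a; rewrite // inE eqxx.
have <- : #|[set ed e | e in s]| = size s.
  rewrite card_in_imset; first by apply/card_uniqP.
  by move=> e e' h h' eq; case: (disj e h e' h') => //; rewrite eq (negbTE (nz _)).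
apply: (@leq_bigmax_cond _ (@matching G) (fun M => #|M|)); apply/andP; split.
  apply/subsetP=> _ /imsetP [e h ->]; apply/imsetP; exists e => //.
  by rewrite inE; apply: (allP es).
apply/trivIsetP=> _ _ /imsetP [e h ->] /imsetP [e' h' ->] ne.
by case: (disj e h e' h') ne => // ->; rewrite eqxx.
Qed.

(** The easy half of König's theorem: choosing in each matching edge a vertex of [S] is injective by
    disjointness. *)
Lemma max_matching_cover (G : sgraph) (S : {set G}) :
  (forall x y : G, sedge x y -> (x \in S) || (y \in S)) -> max_matching G <= #|S|.
Proof.
move=> cov; apply/bigmax_leqP => M /andP [/subsetP ME triv].
case: (set_0Vmem M) => [->|[e0 e0M]]; first by rewrite cards0.
have ex e : e \in M -> exists x, x \in e :&: S.
  case/ME/imsetP=> [[x y]]; rewrite inE /= => /cov h ->.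
  by case/orP: h => h; [exists x|exists y]; rewrite !inE eqxx ?orbT.
have [x0 _] := ex e0 e0M.
pose g (e : {set G}) := odflt x0 [pick x in e :&: S].
have gP e : e \in M -> g e \in e :&: S.
  by move=> /ex [x hx]; rewrite /g; case: pickP => // /(_ x); rewrite hx.
rewrite -(@card_in_imset _ _ g).
  apply: subset_leq_card; apply/subsetP=> _ /imsetP [e /gP h ->].
  by move: h; rewrite inE => /andP [].
move=> e e' h h' eg; apply/eqP; apply: contraT => ne.
have /pred0P /(_ (g e)) := trivIsetP triv e e' h h' ne.
have := gP e h; have := gP e' h'; rewrite -eg !inE.
by case/andP=> -> _ /andP [-> _].
Qed.

Lemma mm_cover (G : sgraph) (A S : {set G}) :
  (forall x y : G, sedge x y -> x \in A -> y \notin A -> (x \in S) || (y \in S)) ->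
  mm A <= #|S|.
Proof.
move=> cov; apply: (@max_matching_cover (cut_graph A)) => x y /= /andP [e].
case: (boolP (x \in A)) => hx; case: (boolP (y \in A)) => hy // _.
  exact: cov.
by rewrite orbC; apply: cov => //; rewrite sedge_sym.
Qed.

Lemma mm_setC (G : sgraph) (A : {set G}) : mm (~: A) <= mm A.
Proof.
apply/bigmax_leqP => M /andP [ME triv].
apply: (@leq_bigmax_cond _ (@matching (cut_graph A)) (fun M => #|M|)).
apply/andP; split=> //; apply: subset_trans ME _.
apply/subsetP=> _ /imsetP [p hp ->]; apply/imsetP; exists p => //.
by move: hp; rewrite !inE /= /cut_rel !inE; case: (p.1 \in A); case: (p.2 \in A).
Qed.

Lemma grid_sedgeE k (p q : grid k) :
  sedge p q = cell_adj (val p.1, val p.2) (val q.1, val q.2).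
Proof.
case: p q => [[a ha] [b hb]] [[c hc] [d hd]]; rewrite /= /grid_rel /cell_adj /=.
lia.
Qed.

Definition coords k (p : grid k) : cell := (val p.1, val p.2).

Lemma mm_grid_ge k (A : {set grid k}) (P : pred cell) n :
  (forall p, (p \in A) = P (coords p)) -> has_cut_matching k P n -> n <= mm A.
Proof.
(* [inord] requires a nonempty ordinal type; for side 0 no cell is inside and the matching is
   empty. *)
case: k A => [|k] A AP [s [ns cs us]].
  case: s ns cs us => [|e s] ns /=; first by rewrite leqn0 in ns; rewrite (eqP ns).
  by rewrite /cut_edge /inside.
apply: leq_trans ns _.
pose g (p : cell) : grid k.+1 := (inord p.1, inord p.2).
have gK p : inside k.+1 p -> coords (g p) = p.
  by case: p => a b /andP [h1 h2]; rewrite /coords /g /= !inordK.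
have ends e : e \in s -> inside k.+1 e.1 /\ inside k.+1 e.2.
  by move=> /(allP cs) /and4P [].
rewrite -(size_map (fun e : cell * cell => (g e.1, g e.2))).
apply: (@max_matching_ge (cut_graph A)).
  apply/allP=> _ /mapP [e es ->] /=; have [i1 i2] := ends e es.
  have /and4P [_ _ ad ne] := allP cs e es.
  by rewrite /cut_rel !AP grid_sedgeE -!/(coords _) !gK // ad.
rewrite (endpoints_map g) map_inj_in_uniq // => x y hx hy eg.
have ins z : z \in endpoints s -> inside k.+1 z.
  by case/mem_endpoints=> e /ends [i1 i2] /orP [] /eqP ->.
by rewrite -(gK x (ins x hx)) eg gK // ins.
Qed.

(** * Full rows and columns in cuts of small matching number *)

Definition has_row k (A : {set grid k}) : Prop :=
  exists i : 'I_k, forall j : 'I_k, (i, j) \in A.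

Definition has_column k (A : {set grid k}) : Prop :=
  exists j : 'I_k, forall i : 'I_k, (i, j) \in A.

Lemma has_row_column k (A B : {set grid k}) :
  has_row A -> has_column B -> exists2 p, p \in A & p \in B.
Proof. by move=> [i hi] [j hj]; exists (i, j). Qed.

(** The colouring claim concerns functions on all cells; [x0] is a filler outside the square. *)
Definition extend (T : Type) (x0 : T) k (f : grid k -> T) (p : cell) : T :=
  if insub p.1 is Some i then if insub p.2 is Some j then f (i, j) else x0 else x0.

Lemma extend_coords (T : Type) (x0 : T) k (f : grid k -> T) p :
  extend x0 f (coords p) = f p.
Proof. by rewrite /extend /coords /= !valK -surjective_pairing. Qed.

Lemma extend_ord (T : Type) (x0 : T) k (f : grid k -> T) (i j : 'I_k) :
  extend x0 f (i : nat, j : nat) = f (i, j).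
Proof. exact: (@extend_coords _ x0 k f (i, j)). Qed.

Lemma rows_mixed_extend (T : eqType) (x0 : T) k (f : grid k -> T) :
  rows_mixed k (extend x0 f) \/
  exists (i : 'I_k) c, forall j : 'I_k, f (i, j) = c.
Proof.
case: (rows_mixed_dec k (extend x0 f)) => [|[r [c [rk h]]]]; first by left.
right; exists (Ordinal rk), c => j; rewrite -(extend_ord x0); exact: h.
Qed.

Lemma columns_mixed_extend (T : eqType) (x0 : T) k (f : grid k -> T) :
  rows_mixed k (extend x0 f \o swap) \/
  exists (j : 'I_k) c, forall i : 'I_k, f (i, j) = c.
Proof.
case: (rows_mixed_dec k (extend x0 f \o swap)) => [|[r [c [rk h]]]]; first by left.
right; exists (Ordinal rk), c => j; rewrite -(extend_ord x0); exact: h.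
Qed.

Lemma mm_lt_row k (A : {set grid k}) : mm A < k -> has_row A \/ has_row (~: A).
Proof.
move=> lt; case: (@rows_mixed_extend _ false k (fun p => p \in A)) => [|[i [c h]]].
  move/rows_matching => hm; suff: k <= mm A by rewrite leqNgt lt.
  by apply: mm_grid_ge hm => p; rewrite extend_coords.
case: c h => h; [left|right]; exists i => j; by rewrite ?inE h.
Qed.

Lemma mm_lt_column k (A : {set grid k}) :
  mm A < k -> has_column A \/ has_column (~: A).
Proof.
move=> lt; case: (@columns_mixed_extend _ false k (fun p => p \in A)) => [|[i [c h]]].
  move/rows_matching/has_cut_matching_swap => hm; suff: k <= mm A by rewrite leqNgt lt.
  by apply: mm_grid_ge hm => p; rewrite extend_coords.
case: c h => h; [left|right]; exists i => j; by rewrite ?inE h.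
Qed.

(** If [A] has no row, its complement has one, which meets every column; so [A] has no column. The
    converse is symmetric. *)
Lemma mm_lt_small k (A : {set grid k}) : mm A < k -> ~ has_row A \/ ~ has_column A ->
  ~ has_row A /\ ~ has_column A.
Proof.
have disj B C : has_row B -> has_column C -> ~ (B \subset ~: C).
  move=> hB hC /subsetP h; have [p pB pC] := has_row_column hB hC.
  by move: (h p pB); rewrite inE pC.
move=> lt [nr|nc]; split=> // h.
  have {}nr : has_row (~: A) by case: (mm_lt_row lt).
  exact: disj nr h _.
have {}nc : has_column (~: A) by case: (mm_lt_column lt).
by apply: disj h nc _; rewrite setCK.
Qed.

(** The parts are the classes of a 3-colouring, and a monochromatic line would be a full line in
    some part. *)
Lemma three_parts_mm k (A B : {set grid k}) : [disjoint A & B] ->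
  let C := ~: (A :|: B) in
  (forall X, X \in [:: A; B; C] -> ~ has_row X /\ ~ has_column X) ->
  exists2 X, X \in [:: A; B; C] & k <= mm X.
Proof.
move=> dAB C small.
pose f (p : grid k) := if p \in A then 0 else if p \in B then 1 else 2.
pose part c := if c is 0 then A else if c is 1 then B else C.
have fP p c : c < 3 -> (p \in part c) = (f p == c).
  have /= := pred0P dAB p.
  by case: c => [|[|[|//]]] + _; rewrite /f /part /C ?inE; case: (p \in A); case: (p \in B).
have f3 p : f p < 3 by rewrite /f; case: ifP => // _; case: ifP.
have part_in c : c < 3 -> part c \in [:: A; B; C].
  by case: c => [|[|[|//]]] _; rewrite !inE eqxx ?orbT.
have F3 p : extend 0 f p < 3.
  by rewrite /extend; case: insubP => // i _ _; case: insubP.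
case: (@three_colour k (extend 0 f) F3).
- case: (rows_mixed_extend 0 f) => // [[i [c h]]].
  have c3 : c < 3 by rewrite -(h i).
  have [nr _] := small _ (part_in c c3).
  by case: nr; exists i => j; rewrite fP // h.
- case: (columns_mixed_extend 0 f) => // [[i [c h]]].
  have c3 : c < 3 by rewrite -(h i).
  have [_ nr] := small _ (part_in c c3).
  by case: nr; exists i => j; rewrite fP // h.
- move=> c c3 hm; exists (part c); first exact: part_in.
  by apply: mm_grid_ge hm => p; rewrite fP // /colour_class extend_coords.
Qed.

(** * Tree edges and branch-decompositions *)

Section TreeEdge.
Variables (G : sgraph) (treeG : is_tree G).

(** The connectivity used in [bd_side], on all tree vertices instead of leaf labels. *)
Definition edge_comp (u v : G) : {set G} :=
  [set x | connect (@sedge (del_edge u v)) u x].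

Lemma edge_comp_refl u v : u \in edge_comp u v.
Proof. by rewrite inE connect0. Qed.

(** A simple path from [u] to [v] avoiding the edge [uv] would close up with it to a cycle. *)
Lemma tree_edge_bridge u v : sedge u v -> v \notin edge_comp u v.
Proof.
move=> uv; rewrite inE; apply/negP=> /connectP [p0 hp0 lastv].
case/shortenP: hp0 lastv => p hp up _ lastv.
have [_ acyc] := treeG; apply: (acyc (u :: p)).
  (* Length 0 would make [uv] a loop, and length 1 would be the deleted edge. *)
  case: p hp up lastv => [|a [|b p]] //=.
    by move=> _ _ e; rewrite e sedge_irr in uv.
  by rewrite andbT /del_edge_rel => /andP [_ +] _ e; rewrite e eqxx.
rewrite /ucycle up andbT /= rcons_path -lastv [sedge v u]sedge_sym uv andbT.
by apply: sub_path hp => x y /andP [].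
Qed.

Lemma path_avoiding (u v w : G) p : path (@sedge G) w p -> u \notin w :: p ->
  path (@sedge (del_edge u v)) w p.
Proof.
elim: p w => //= a p IH w /andP [wa pa]; rewrite !inE !negb_or => /and3P [uw ua up].
rewrite IH // ?andbT; last by rewrite inE negb_or ua.
rewrite /del_edge_rel wa /=; apply: contraNneq uw => e.
have : u \in [set w; a] by rewrite e !inE eqxx.
by rewrite !inE (negbTE ua) orbF.
Qed.

Lemma del_edgeC (u v : G) : del_edge_rel u v =2 del_edge_rel v u.
Proof. by move=> x y; rewrite /del_edge_rel [[set u; v]]setUC. Qed.

Lemma edge_comp_path u v x : x \in edge_comp u v -> sedge u v ->
  exists p, [/\ path (@sedge G) u p, v \notin u :: p & x = last u p].
Proof.
rewrite inE => /connectP [p hp ->] uv; exists p; split=> //.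
  by apply: sub_path hp => a b /andP [].
apply/negP=> /splitPl h; case: p / h hp => p1 p2 e; rewrite cat_path => /andP [hp _].
by case/negP: (tree_edge_bridge uv); rewrite inE; apply/connectP; exists p1.
Qed.

(** A path from [w] avoiding [u] survives the deletion of [uv], and the edge [uw] can be put in
    front of it. *)
Lemma edge_comp_sub u v w : sedge u v -> sedge u w -> v != w ->
  edge_comp w u \subset edge_comp u v.
Proof.
move=> uv uw vw; apply/subsetP=> x hx.
have [|p [hp up ->]] := edge_comp_path hx; first by rewrite sedge_sym.
rewrite inE; apply/connectP; exists (w :: p) => //=.
rewrite path_avoiding // andbT /del_edge_rel uw /=.
apply: contraNneq vw => e; have : v \in [set u; w] by rewrite e !inE eqxx orbT.
rewrite !inE => /orP [] // /eqP vu; by rewrite vu sedge_irr in uv.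
Qed.

Lemma edge_comp_disjoint u v : sedge u v -> [disjoint edge_comp u v & edge_comp v u].
Proof.
move=> uv; apply/pred0P=> x /=; rewrite !inE; apply/negP=> /andP [ux vx].
have := tree_edge_bridge uv; rewrite inE => /negP; apply.
apply: connect_trans ux _; rewrite (eq_connect (@del_edgeC u v)).
by rewrite (sym_connect_sym (@del_edge_sym G v u)).
Qed.

(** [w] is the first step of a simple path from [u] to [x], which never returns to [u]. *)
Lemma edge_comp_cover u x : x != u -> exists2 w, sedge u w & x \in edge_comp w u.
Proof.
move=> xu; have [[_ /(_ u x) /connectP [p0 hp0 ex]] _] := treeG.
case/shortenP: hp0 ex => [[|w p]] /= hp up _ ex; first by rewrite ex eqxx in xu.
case/andP: hp => uw hp; case/andP: up => uwp _.
exists w => //; rewrite inE (eq_connect (@del_edgeC w u)); apply/connectP; exists p => //.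
exact: path_avoiding.
Qed.

Lemma edge_compC u v : sedge u v -> ~: edge_comp u v = edge_comp v u.
Proof.
move=> uv; apply/setP=> x; rewrite in_setC; apply/idP/idP => [nx|hx]; last first.
  have /pred0P /(_ x) /= := edge_comp_disjoint uv; rewrite hx andbT => ->. by [].
have xu : x != u by apply: contraNneq nx => ->; exact: edge_comp_refl.
have [w uw hw] := edge_comp_cover xu.
have [<- //|vw] := eqVneq w v.
by move: nx; rewrite (subsetP (edge_comp_sub uv uw _)) // eq_sym.
Qed.

End TreeEdge.

Section Sides.
Variables (X : finType) (D : branch_decomposition X).
Let T := bd_tree D.
Let treeT := bd_is_tree D.

Lemma bd_sideE (u v : T) x :
  (x \in bd_side u v) = [exists l : leaf T, (val l \in edge_comp u v) && (bd_label l == x)].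
Proof.
apply/imsetP/existsP => [[l hl ->]|[l /andP [hl /eqP <-]]].
  by exists l; rewrite eqxx andbT inE; move: hl; rewrite inE.
by exists l => //; move: hl; rewrite !inE.
Qed.

Lemma mem_bd_side (u v : T) (l : leaf T) :
  (bd_label l \in bd_side u v) = (val l \in edge_comp u v).
Proof.
rewrite bd_sideE; apply/existsP/idP => [[l' /andP [h /eqP e]]|h].
  by rewrite -(bij_inj (@bd_label_bij X D) e).
by exists l; rewrite h eqxx.
Qed.

Lemma bd_label_onto x : exists l : leaf T, bd_label l = x.
Proof. by have [g _ gK] := @bd_label_bij X D; exists (g x). Qed.

Lemma bd_sideC (u v : T) : sedge u v -> ~: bd_side u v = bd_side v u.
Proof.
move=> uv; apply/setP=> x; have [l <-] := bd_label_onto x.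
by rewrite in_setC !mem_bd_side -(edge_compC treeT uv) in_setC.
Qed.

End Sides.

(** * Descent through the tree *)

Lemma mm_le_width (G : sgraph) (D : branch_decomposition G) (u v : bd_tree D) :
  sedge u v -> mm (bd_side u v) <= bd_width D.
Proof.
move=> uv; exact: (@leq_bigmax_cond _ (fun p : bd_tree D * bd_tree D => sedge p.1 p.2)
  (fun p => mm (bd_side p.1 p.2)) (u, v)).
Qed.

Lemma has_rowP k (A : {set grid k}) :
  reflect (has_row A) [exists i : 'I_k, forall j : 'I_k, (i, j) \in A].
Proof. by apply: (iffP existsP) => -[i h]; exists i; apply/forallP. Qed.

Lemma deg_neighbours (G : sgraph) (u v : G) : deg u = 3 -> sedge u v ->
  exists w w', [/\ sedge u w, sedge u w', (v != w) && (v != w'), w != w' &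
    forall x, sedge u x -> x \in [:: v; w; w']].
Proof.
move=> d3 uv; pose N := [set y | sedge u y].
have : #|N :\ v| = 2.
  by have := cardsD1 v N; rewrite -/(deg u) d3 inE uv add1n => -[].
move/eqP/cards2P=> [w [w' [ww' e]]].
have hw x : (x \in N :\ v) = (x \in [set w; w']) by rewrite e.
have := hw w; have := hw w'; rewrite !inE !eqxx orbT /= => /andP [n1 e1] /andP [n2 e2].
exists w, w'; split=> // [|x ux]; first by rewrite ![v == _]eq_sym n1 n2.
have := hw x; rewrite !inE ux andbT.
by case: eqVneq => //= _ <-.
Qed.

Lemma bd_side_leaf (X : finType) (D : branch_decomposition X) (u v : bd_tree D) :
  sedge u v -> deg u = 1 -> #|bd_side u v| <= 1.
Proof.
move=> uv d1; suff comp x : x \in edge_comp u v -> x = u.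
  apply/card_le1_eqP => x y; have [l <-] := bd_label_onto D x; have [l' <-] := bd_label_onto D y.
  by rewrite !mem_bd_side => /comp e /comp e'; congr bd_label; apply: val_inj; rewrite e e'.
rewrite inE => /connectP [[|w p] //= /andP [/andP [uw +] _] _]; case/negP.
have /cards1P [z ez] : deg u == 1 by rewrite d1.
have : v \in [set z] by rewrite -ez inE.
have : w \in [set z] by rewrite -ez inE.
by rewrite !inE => /eqP -> /eqP ->.
Qed.

(** At a cubic node [u], if neither side beyond [u] contained a row, the three parts at [u] would
    contain no row or column, contradicting [three_parts_mm]. The component shrinks because it loses
    [u]. *)
Lemma big_side_descend k (D : branch_decomposition (grid k)) (u v : bd_tree D) :
  1 < k -> bd_width D < k -> sedge u v -> has_row (bd_side u v) ->
  exists w, [/\ sedge w u, has_row (bd_side w u) &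
                #|edge_comp w u| < #|edge_comp u v|].
Proof.
move=> k1 wlt uv big.
have treeT := bd_is_tree D.
have mlt (x y : bd_tree D) : sedge x y -> mm (bd_side x y) < k.
  by move=> xy; apply: (leq_ltn_trans _ wlt); exact: mm_le_width.
case: (bd_subcubic u) => [d1|d3].
  case: big => i hi.
  (* The side of a leaf has at most one cell, but a row has two since [1 < k]. *)
  have /card_le1_eqP h := bd_side_leaf uv d1.
  have k0 : 0 < k by lia.
  by have [] := h (i, Ordinal k0) (i, Ordinal k1) (hi _) (hi _).
have [w [w' [uw uw' /andP [vw vw'] ww' nb]]] := deg_neighbours d3 uv.
have smaller x : sedge u x -> v != x -> #|edge_comp x u| < #|edge_comp u v|.
  move=> ux vx; apply: proper_card; apply/properP; split.
    exact: edge_comp_sub.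
  by exists u; [exact: edge_comp_refl|apply: tree_edge_bridge; rewrite // sedge_sym].
case: (has_rowP (bd_side w u)) => [h|nw]; first by exists w; rewrite sedge_sym uw smaller.
case: (has_rowP (bd_side w' u)) => [h|nw']; first by exists w'; rewrite sedge_sym uw' smaller.
exfalso.
have wu : sedge w u by rewrite sedge_sym.
have wu' : sedge w' u by rewrite sedge_sym.
have vu : sedge v u by rewrite sedge_sym.
have dis : [disjoint bd_side w u & bd_side w' u].
  apply/pred0P=> x /=; have [l <-] := bd_label_onto D x; rewrite !mem_bd_side.
  apply/negP=> /andP [h h'].
  have h2 : val l \in edge_comp u w'.
    by apply: (subsetP (edge_comp_sub treeT uw' uw _)); rewrite // eq_sym.
  by have /pred0P /(_ (val l)) /= := edge_comp_disjoint treeT uw'; rewrite h2 h'.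
have eqv : ~: (bd_side w u :|: bd_side w' u) = bd_side v u.
  rewrite -(bd_sideC uv); congr (~: _); apply/setP=> x.
  have [l <-] := bd_label_onto D x; rewrite in_setU !mem_bd_side.
  apply/orP/idP => [[]|hx].
  - by apply: (subsetP (edge_comp_sub treeT uv uw _)).
  - by apply: (subsetP (edge_comp_sub treeT uv uw' _)).
  (* [u] has degree 3 and is no leaf, so every leaf lies beyond one of its three neighbours. *)
  have lu : val l != u.
    apply/eqP=> e; have := valP l; by rewrite /= e d3.
  have [x' ux' hx'] := edge_comp_cover treeT lu.
  have /or3P : [|| x' == v, x' == w | x' == w'] by have := nb x' ux'; rewrite !inE.
  case=> /eqP e; subst x'; [|by left|by right].
  by have /pred0P /(_ (val l)) /= := edge_comp_disjoint treeT uv; rewrite hx hx'.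
(* The row on the opposite side meets every column. *)
have ncol : ~ has_column (bd_side v u).
  move=> hc; have [p p1 p2] := has_row_column big hc.
  by move: p2; rewrite -(bd_sideC uv) inE p1.
have := three_parts_mm dis; rewrite /= eqv => -[X|X].
  rewrite !inE => /or3P [] /eqP ->; apply: mm_lt_small; try exact: mlt.
  - by left.
  - by left.
  - by right.
by rewrite !inE => /or3P [] /eqP ->; rewrite leqNgt mlt.
Qed.

Lemma grid_width_ge k (D : branch_decomposition (grid k)) : 1 < k -> k <= bd_width D.
Proof.
move=> k1; rewrite leqNgt; apply/negP=> wlt.
have treeT := bd_is_tree D.
(* Infinite descent on the size of the component; it starts from either side of an arbitrary
   edge. *)
have noBig n : forall u v : bd_tree D, sedge u v -> has_row (bd_side u v) ->
    #|edge_comp u v| <= n -> False.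
  elim: n => [|n IH] u v uv big.
    by rewrite leqn0 cards_eq0 => /eqP e; have := edge_comp_refl u v; rewrite e inE.
  move=> le; have [w [wu bw lt]] := big_side_descend k1 wlt uv big.
  by apply: IH wu bw _; rewrite -ltnS; apply: leq_trans lt _.
have [[/card_gt0P [u _] _] _] := treeT.
have [v uv] : exists v, sedge u v.
  have : 0 < deg u by case: (bd_subcubic u) => ->.
  by case/card_gt0P=> v; rewrite inE; exists v.
have mlt : mm (bd_side u v) < k by apply: (leq_ltn_trans _ wlt); exact: mm_le_width.
have vu : sedge v u by rewrite sedge_sym.
case: (mm_lt_row mlt) => big; first exact: noBig uv big (leqnn _).
by rewrite bd_sideC // in big; exact: noBig vu big (leqnn _).
Qed.

(** * The row-major caterpillar *)

(* The spine of the caterpillar is [0, 1, 3, 5, ..., 2n - 3] and each even vertex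
   [2m > 0] hangs from [2m - 1]; the truncated subtraction makes [0] the parent of [1]. *)
Definition cat_parent (x : nat) : nat := if odd x then x - 2 else x - 1.

Section Caterpillar.
Variable n : nat.
Hypothesis n_gt2 : 2 < n.
(** A cubic tree with [n] leaves has [n - 2] inner vertices. *)
Let N := n.-1.*2.

Definition cat_rel : rel 'I_N :=
  fun x y => (x < y) && (cat_parent y == x) || (y < x) && (cat_parent x == y).

Lemma cat_sym : symmetric cat_rel.
Proof. by move=> x y; rewrite /cat_rel orbC. Qed.

Lemma cat_irr : irreflexive cat_rel.
Proof. by move=> x; rewrite /cat_rel ltnn. Qed.

Definition caterpillar : sgraph := SGraph cat_sym cat_irr.

Lemma cat_parent_lt x : 0 < x -> cat_parent x < x.
Proof. by rewrite /cat_parent; case: ifP; lia. Qed.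

Lemma cat_size_gt3 : 3 < N.
Proof. by rewrite /N; lia. Qed.

Lemma cat_size_gt0 : 0 < N.
Proof. exact: ltn_trans cat_size_gt3. Qed.

(** Parents lead down to 0. The largest vertex of a cycle would have two smaller neighbours, but
    only its parent is smaller. *)
Lemma caterpillar_tree : is_tree caterpillar.
Proof.
split; first split.
- by rewrite card_ord cat_size_gt0.
- pose o : caterpillar := Ordinal cat_size_gt0.
  have toO m : forall x : caterpillar, x <= m -> connect cat_rel x o.
    elim: m => [|m IH] x xm.
      by have -> : x = o by apply: val_inj => /=; lia.
    case: (posnP x) => [x0|x0]; first by have -> : x = o by exact: val_inj.
    have lt := cat_parent_lt x0.
    pose y : caterpillar := Ordinal (ltn_trans lt (ltn_ord x)).
    apply: (connect_trans (y := y)); last by apply: IH; rewrite /=; lia.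
    by apply: connect1; rewrite /cat_rel /= lt eqxx orbT.
  move=> x y; apply: connect_trans (toO _ x (leqnn _)) _.
  by rewrite (sym_connect_sym cat_sym); apply: toO _ y (leqnn _).
- move=> c c2 /andP [cyc uc].
  have [x0 x0c] : exists x, x \in c by case: c c2 {cyc uc} => // x c; exists x; exact: mem_head.
  case: (arg_maxnP (fun x : caterpillar => x : nat) x0c) => x xc xmax.
  have [i p ep] := rot_to xc.
  have {cyc} : cycle cat_rel (x :: p) by rewrite -ep rot_cycle.
  have {uc} : uniq (x :: p) by rewrite -ep rot_uniq.
  have {c2} : 2 < size (x :: p) by rewrite -ep size_rot.
  have up (y : 'I_N) : y \in p -> cat_rel x y -> y = cat_parent x :> nat.
    move=> yp; have yc : y \in c by rewrite -(mem_rot i) ep inE yp orbT.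
    have {yc} := xmax y yc; rewrite /cat_rel /= ltnNge => -> /=.
    by case/andP=> _ /eqP.
  case: p up {ep} => [|y [|z p]] // up _ /= /and3P [_ yp _] /andP [xy].
  rewrite rcons_path => /andP [_] /andP [_]; rewrite cat_sym => xl.
  have e1 := up y (mem_head _ _) xy.
  have e2 := up (last z p) (mem_behead (s := [:: y, z & p]) (mem_last _ _)) xl.
  have e : y = last z p by apply: val_inj; rewrite /= e1 e2.
  by rewrite e mem_last in yp.
Qed.

Lemma caterpillar_deg (x : caterpillar) :
  deg x = if odd x && (x.+2 < N) then 3 else 1.
Proof.
have xN := ltn_ord x; case: ifP => h.
  (* An inner spine vertex is adjacent to its parent, its pendant leaf [x.+1] and the next spine
     vertex [x.+2]. *)
  have p1 : cat_parent x < N by rewrite /cat_parent; case: ifP; lia.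
  have p2 : x.+1 < N by lia.
  have p3 : x.+2 < N by lia.
  have -> : deg x = #|[set Ordinal p1; Ordinal p2; Ordinal p3]|.
    congr #|pred_of_set _|; apply/setP=> y; rewrite !inE /= /cat_rel -!val_eqE /=.
    by move: h; rewrite /cat_parent; case: (boolP (odd x)); case: (boolP (odd y)); lia.
  rewrite -setUA cardsU1 cards2 !inE -!val_eqE /= /cat_parent.
  by case: ifP; lia.
have p1 : (if x == 0 :> nat then 1 else cat_parent x) < N.
  by have := cat_size_gt3; rewrite /cat_parent; case: (boolP (odd x)); case: eqP; lia.
have -> : deg x = #|[set Ordinal p1]|; last by rewrite cards1.
congr #|pred_of_set _|; apply/setP=> y; rewrite !inE /= /cat_rel -!val_eqE /=.
have yN := ltn_ord y; have : ~~ odd N by rewrite /N; lia.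
by move: h; rewrite /cat_parent; case: (boolP (odd x)); case: (boolP (odd y));
  case: (boolP (x == 0 :> nat)); lia.
Qed.

Lemma caterpillar_subcubic : subcubic caterpillar.
Proof. by move=> x; rewrite caterpillar_deg; case: ifP; [right|left]. Qed.

Lemma cat_leafE (x : caterpillar) : (deg x == 1) = (~~ odd x || (x == N.-1 :> nat)).
Proof.
have xN := ltn_ord x; have : ~~ odd N by rewrite /N; lia.
by rewrite caterpillar_deg; case: ifP; lia.
Qed.

(** Leaves are numbered along the spine: [2m] gets [m], and the last spine vertex [2n - 3] gets
    [n - 1]. *)
Lemma cat_leaf_index_lt (l : leaf caterpillar) : uphalf (val l : 'I_N) < n.
Proof. by have := ltn_ord (val l : 'I_N); rewrite {2}/N; lia. Qed.

Definition cat_leaf_index (l : leaf caterpillar) : 'I_n := Ordinal (cat_leaf_index_lt l).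

Lemma cat_leaf_of_lt (i : 'I_n) : (if i == n.-1 :> nat then N.-1 else i.*2) < N.
Proof. by have := ltn_ord i; rewrite /N; case: ifP; lia. Qed.

Lemma cat_leaf_of_deg (i : 'I_n) : deg (Ordinal (cat_leaf_of_lt i) : caterpillar) == 1.
Proof. by rewrite cat_leafE /=; case: ifP; rewrite ?eqxx ?orbT ?odd_double. Qed.

Lemma cat_leaf_index_bij : bijective cat_leaf_index.
Proof.
exists (fun i => exist (fun x : caterpillar => deg x == 1) _ (cat_leaf_of_deg i)).
  case=> x hx; apply: val_inj; apply: val_inj => /=.
  by move: (hx) (ltn_ord x); rewrite cat_leafE /N; case: ifP; lia.
by move=> i; apply: val_inj => /=; have := ltn_ord i; rewrite /N; case: ifP; lia.
Qed.

End Caterpillar.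

(** * Cuts of the caterpillar *)

(** Only [uv] crosses [Z], so [Z] and its complement are closed after deleting it; they contain the
    components of [u] and [v], which are complementary. *)
Lemma edge_comp_eq (G : sgraph) (u v : G) (Z : {set G}) : is_tree G -> sedge u v ->
  u \in Z -> v \notin Z ->
  (forall x y, sedge x y -> (x \in Z) != (y \in Z) -> [set x; y] = [set u; v]) ->
  edge_comp u v = Z.
Proof.
move=> treeG uv uZ vZ hZ.
have cl a b : [set a; b] = [set u; v] -> closed (del_edge_rel a b) (mem Z).
  move=> e x y /andP [xy ne]; apply/eqP; apply: contraNT ne => /(hZ x y xy) ->.
  by rewrite e.
apply/setP=> x; apply/idP/idP.
  by rewrite inE => /(closed_connect (cl u v erefl)) <-.
apply: contraTT; rewrite -in_setC edge_compC // inE.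
by move/(closed_connect (cl v u (setUC _ _))) => /= <-.
Qed.

Lemma mm_le_card (G : sgraph) (A : {set G}) : mm A <= #|A|.
Proof. by apply: mm_cover => x y _ ->. Qed.

Lemma caterpillar_width (G : sgraph) n (g : 'I_n -> G) w : 2 < n -> bijective g ->
  0 < w -> (forall m, mm [set g i | i : 'I_n & i < m] <= w) ->
  exists D : branch_decomposition G, bd_width D <= w.
Proof.
move=> n2 gbij w0 hw.
pose lab (l : leaf (caterpillar n)) := g (cat_leaf_index n2 l).
have labbij : bijective lab by apply: bij_comp gbij (cat_leaf_index_bij n2).
pose D := BranchDecomposition (caterpillar_tree n2) (caterpillar_subcubic n2) labbij.
have treeT := bd_is_tree D.
exists D; apply/bigmax_leqP => -[u v] /= uv.
(* Complementary sides have the same cut, so [u] may be taken as the parent of [v]. *)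
wlog lt : u v uv / u < v.
  move=> H; have vu : @sedge (bd_tree D) v u by rewrite sedge_sym.
  case: (ltngtP u v) => [|lt|e]; first exact: H.
    by rewrite -(bd_sideC vu); apply: leq_trans (mm_setC _) _; apply: H.
  by move: uv; rewrite (val_inj e) /= cat_irr.
have {uv} [uv pv] : @sedge (bd_tree D) u v /\ cat_parent v = u :> nat.
  by split=> //; move: uv; rewrite /= /cat_rel; lia.
have vu : @sedge (bd_tree D) v u by rewrite sedge_sym.
(* A spine edge separates the vertices below [v] from the rest, hence a prefix of the leaves. *)
case: (boolP (odd v)) => ov.
  have -> : bd_side u v = [set g i | i : 'I_n & i < uphalf v]; last exact: hw.
  have ec : edge_comp u v = [set x : caterpillar n | x < v].
    apply: edge_comp_eq => //; rewrite ?inE ?ltnn // => x y.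
    rewrite /= /cat_rel !inE => xy ne.
    have : (x == u :> nat) && (y == v :> nat) || (x == v :> nat) && (y == u :> nat).
      move: xy ne pv lt ov; rewrite /cat_parent.
      case: (boolP (odd x)); case: (boolP (odd y)); case: (boolP (odd v)); lia.
    by case/orP=> /andP [/eqP/val_inj -> /eqP/val_inj ->]; rewrite // setUC.
  apply/setP=> x; have [l <-] := bd_label_onto D x; rewrite mem_bd_side ec inE.
  rewrite /= /lab mem_imset ?inE /=; last exact: bij_inj.
  by have := valP l; rewrite /= cat_leafE //; have := ltn_ord v; lia.
(* For even [v] the edge is pendant, and a single label has matching number at most 1. *)
rewrite -(bd_sideC vu); apply: leq_trans (mm_setC _) _.
apply: leq_trans w0; apply: leq_trans (mm_le_card _) _; apply: bd_side_leaf vu _.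
by rewrite /= caterpillar_deg // (negbTE ov).
Qed.

(** * Row-major order of the grid *)

Section RowMajor.
Variable k : nat.

Definition grid_index (p : grid k) : nat := p.1 * k + p.2.

Lemma grid_index_lt p : grid_index p < k * k.
Proof.
have h1 := ltn_ord p.1; have h2 := ltn_ord p.2; rewrite /grid_index.
have : p.1.+1 * k <= k * k by rewrite leq_mul2r h1 orbT.
by rewrite mulSn; lia.
Qed.

Lemma grid_index_bij : bijective (fun p : grid k => Ordinal (grid_index_lt p)).
Proof.
apply: inj_card_bij; last by rewrite card_prod !card_ord.
move=> [a b] [c d] /(congr1 val) /= e.
have k0 : 0 < k by have := ltn_ord a; lia.
have ea : a = c.
  apply: val_inj; have /= := congr1 (divn^~ k) e.
  by rewrite /grid_index /= !divnMDl // !divn_small // !addn0.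
by congr (_, _) => //; apply: val_inj; move: e; rewrite /grid_index ea /= => /addnI.
Qed.

Lemma card_ord_interval n a b : #|[set i : 'I_n | a <= i < a + b]| <= b.
Proof.
rewrite cardE -(size_map val) -[leqRHS](size_iota a b); apply: uniq_leq_size.
  by rewrite map_inj_uniq ?enum_uniq //; exact: val_inj.
by move=> _ /mapP [i + ->]; rewrite mem_enum inE mem_iota.
Qed.

(* The last [k] cells of a row-major prefix meet every edge leaving it. *)
Lemma mm_row_major m : mm [set p : grid k | grid_index p < m] <= k.
Proof.
(* For [m < k] the truncated start is 0, and the window of length [k] contains the whole prefix. *)
pose S := [set p : grid k | m - k <= grid_index p < m - k + k].
apply: leq_trans (_ : #|S| <= k).
  apply: mm_cover => x y; rewrite grid_sedgeE !inE /cell_adj /grid_index /=.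
  move=> adj hx hy; apply/orP; left.
  have xk := ltn_ord x.2; have yk := ltn_ord y.2.
  case/orP: adj => /andP [/eqP e]; first by rewrite e in hx *; lia.
  by case/orP=> /eqP e1; move: hx hy; rewrite e1 e ?mulSn; lia.
rewrite -(card_imset _ (bij_inj grid_index_bij)).
apply: leq_trans (card_ord_interval (k * k) (m - k) k).
apply: subset_leq_card; apply/subsetP=> _ /imsetP [p + ->].
by rewrite !inE.
Qed.

End RowMajor.

Lemma grid_width_le k : 1 < k -> exists D : branch_decomposition (grid k), bd_width D <= k.
Proof.
move=> k1; have [g idxK gK] := grid_index_bij k.
apply: (@caterpillar_width _ (k * k) g).
- by apply: (@leq_trans (2 * 2)) => //; apply: leq_mul.
- by exists (fun p => Ordinal (grid_index_lt p)).
- exact: ltnW.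
move=> m; have -> : [set g i | i : 'I_(k * k) & i < m] = [set p | grid_index p < m].
  apply/setP=> p; rewrite inE -[p in LHS]idxK mem_imset ?inE //.
  exact: can_inj gK.
exact: mm_row_major.
Qed.

Theorem theorem4p7 (k : nat) (hk : 2 <= k) : mmw_is (grid k) k.
Proof.
split; last by move=> D; exact: grid_width_ge.
have [D wD] := grid_width_le hk.
by exists D; apply/eqP; rewrite eqn_leq wD grid_width_ge.
Qed.
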